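(* Let $\mathbf r,\mathbf c\in\mathbb Z_{>0}^3$ with $r_1+r_2+r_3=c_1+c_2+c_3$, and let $\operatorname{T}_{\mathbf r\mathbf c}$ be the corresponding $3\times3$ transportation polytope. If $\operatorname{T}_{\mathbf r\mathbf c}$ is not a multiple of the Birkhoff polytope $B_3$ (i.e. it is not the case that $\mathbf r=\mathbf c=(k,k,k)$ for some positive integer $k$), then the toric ideal $I_{\operatorname{T}_{\mathbf r\mathbf c}}$ has a squarefree quadratic initial ideal, i.e. there is a term order for which the initial ideal of $I_{\operatorname{T}_{\mathbf r\mathbf c}}$ is generated by squarefree monomials of degree $2$.
   Context: The $3\times3$ transportation polytope $\operatorname{T}_{\mathbf r\mathbf c}\subset\mathbb R^{9}$ is the set of all real nonnegative $3\times3$ matrices with row sums $r_1,r_2,r_3$ and column sums $c_1,c_2,c_3$; $B_3=\operatorname{T}_{(1,1,1),(1,1,1)}$, so $kB_3=\operatorname{T}_{(k,k,k),(k,k,k)}$. For a lattice polytope $P\subset\mathbb R^d$ with lattice points $P\cap\mathbb Z^d=\{\mathbf a_1,\ldots,\mathbf a_r\}$, the toric ideal $I_P$ is the kernel of the ring homomorphism $\mathbb k[x_1,\ldots,x_r]\to\mathbb k[t_0^{\pm1},\ldots,t_d^{\pm1}]$, $x_i\mapsto t_0\,t_1^{a_{1i}}\cdots t_d^{a_{di}}$ ($\mathbb k$ a field). *)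

(* Defs.v *)
From HB Require Import structures.
From mathcomp Require Import all_boot all_order all_algebra.
From mathcomp Require Import fraction mpoly.
From mathcomp Require Import reals.

Set Implicit Arguments.
Unset Strict Implicit.
Unset Printing Implicit Defensive.

Import Order.TTheory GRing.Theory Num.Theory.
Local Open Scope ring_scope.

(* As a subset of R^9: a point v of R^(3*3) is the row-major flattening of a  *)
(* 3 x 3 matrix.                                                              *)
Definition transportation_polytope (R : realType) (r c : 'rV[int]_3) :
    {pred 'rV[R]_(3 * 3)} :=
  fun v => let M : 'M[R]_3 := vec_mx v in
  [&& [forall i, forall j, 0 <= M i j],
      [forall i, \sum_j M i j == (r 0 i)%:~R]
    & [forall j, \sum_i M i j == (c 0 j)%:~R]].

Arguments transportation_polytope : clear implicits.

Definition birkhoff_multiple (r c : 'rV[int]_3) : Prop :=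
  exists k : int, [/\ 0 < k, r = const_mx k & c = const_mx k].

Definition enumerates_lattice_points (R : realType) (d N : nat)
    (P : {pred 'rV[R]_d}) (a : 'I_N -> 'rV[int]_d) : Prop :=
  injective a /\
  forall v : 'rV[int]_d, map_mx intr v \in P <-> exists i, v = a i.

Section Ideals.
Variables (k : fieldType) (N : nat).
Implicit Types (p : {mpoly k[N]}) (S I : {mpoly k[N]} -> Prop).

Definition ideal_generated S p : Prop :=
  exists s : seq ({mpoly k[N]} * {mpoly k[N]}),
    (forall x, x \in s -> S x.2) /\ p = \sum_(x <- s) x.1 * x.2.

(* Totality, compatibility with products and minimality of 1 make le a        *)
(* well-order by Dickson's lemma.                                             *)
Definition term_order (le : rel 'X_{1..N}) : Prop :=
  [/\ reflexive le, antisymmetric le, transitive le, total le &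
      (forall m, le 0%MM m) /\
      (forall m1 m2 m, le m1 m2 -> le (m1 + m)%MM (m2 + m)%MM)].

Definition initial_monomial (le : rel 'X_{1..N}) p (m : 'X_{1..N}) : bool :=
  (m \in msupp p) && all (fun m' => le m' m) (msupp p).

Definition initial_ideal (le : rel 'X_{1..N}) I : {mpoly k[N]} -> Prop :=
  ideal_generated
    (fun q => exists p m, [/\ I p, initial_monomial le p m & q = 'X_[m]]).

Definition squarefree_quadratic (m : 'X_{1..N}) : bool :=
  (mdeg m == 2%N) && [forall i, (m i <= 1)%N].

Definition has_squarefree_quadratic_initial_ideal I : Prop :=
  exists le : rel 'X_{1..N}, term_order le /\
  exists G : seq 'X_{1..N}, all squarefree_quadratic G /\
    forall p, initial_ideal le I p <->
      ideal_generated (fun q => exists2 m, m \in G & q = 'X_[m]) p.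

End Ideals.

Section Toric.
Variables (k : fieldType) (d N : nat).

(* The Laurent polynomial ring k[t_0^{+-1}, ..., t_d^{+-1}] is taken as the   *)
(* subring it is of the field k(t_0, ..., t_d); this does not change kernels. *)
Definition toric_var (j : 'I_d.+1) : {fraction {mpoly k[d.+1]}} :=
  tofrac ('X_j : {mpoly k[d.+1]}).

Definition toric_monomial (v : 'rV[int]_d) : {fraction {mpoly k[d.+1]}} :=
  toric_var ord0 * \prod_(j < d) toric_var (lift ord0 j) ^ v 0 j.

Definition toric_map (a : 'I_N -> 'rV[int]_d) :
    {mpoly k[N]} -> {fraction {mpoly k[d.+1]}} :=
  mmap (fun x : k => tofrac (x%:MP : {mpoly k[d.+1]}))
       (fun i => toric_monomial (a i)).

Definition toric_ideal (a : 'I_N -> 'rV[int]_d) (p : {mpoly k[N]}) : Prop :=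
  toric_map a p = 0.

End Toric.

Arguments toric_ideal k {d N} a p.

Lemma transportation_lattice_points_exist (R : realType) (r c : 'rV[int]_3) :
  exists N (a : 'I_N -> 'rV[int]_(3 * 3)),
    enumerates_lattice_points (transportation_polytope R r c) a.
Proof.
pose B := (\sum_i `|r ord0 i|)%N.
pose f (g : {ffun 'I_(3 * 3) -> 'I_B.+1}) : 'rV[int]_(3 * 3) :=
  \row_j (g j : nat)%:Z.
pose s := [seq v <- undup [seq f g | g : {ffun 'I_(3 * 3) -> 'I_B.+1}] |
            map_mx intr v \in transportation_polytope R r c].
have us : uniq s by rewrite filter_uniq ?undup_uniq.
exists (size s), (fun i => nth 0 s i); split=> [i j /eqP|v].
  by rewrite nth_uniq // => /eqP/val_inj.
split=> [Pv|[i ->]]; last first.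
  by have := mem_nth 0 (ltn_ord i); rewrite mem_filter => /andP[].
suff vs : v \in s.
  have lt_i : (index v s < size s)%N by rewrite index_mem.
  by exists (Ordinal lt_i); rewrite nth_index.
rewrite mem_filter Pv mem_undup /=.
move: Pv => /and3P[/forallP P0 /forallP Pr _].
have v0 i j : 0 <= v 0 (mxvec_index i j).
  by have /forallP/(_ j) := P0 i; rewrite !mxE ler0z.
have vB i j : (`|v ord0 (mxvec_index i j)| < B.+1)%N.
  have /eqP := Pr i.
  rewrite (eq_bigr (fun j => (v 0 (mxvec_index i j))%:~R)); last first.
    by move=> l _; rewrite !mxE.
  rewrite -(rmorph_sum intr) => /intr_inj Er.
  rewrite ltnS /B (bigD1 i) //=; apply: leq_trans (leq_addr _ _).
  rewrite -lez_nat gez0_abs // -Er gez0_abs ?sumr_ge0 // (bigD1 j) //=.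
  by rewrite lerDl sumr_ge0.
apply/imageP; exists [ffun l => inord `|v ord0 l|%N] => //.
apply/rowP => l; case/mxvec_indexP: l => i j.
by rewrite mxE ffunE inordK // gez0_abs.
Qed.

(* Main.v *)
(* The lattice points of a transportation polytope having a line sum at least 2,
   say that of row 0, are ordered by refining the sum of the squares of the
   entries in rows 1 and 2 by a bilinear form in these two rows.

   A set of quadratic binomials with squarefree initial terms is a Groebner
   basis of the toric ideal as soon as two monomials in the same fibre, all of
   whose quadratic factors are minimal in their own fibres, are equal.
   Minimality for the quadratic weight forces all the points u of such a
   monomial to satisfy (row 1, row 2) = (y + s e_i, z + s' e_j) with y, z and the
   signs s, s' depending only on the fibre; so a monomial becomes a 3 x 3 matrix
   of multiplicities with prescribed margins, supported on a subset of the
   vertices of a product of two triangles.  The difference of two such matrices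
   contains a conformal circuit.  A circuit of length 4 is a quadratic relation,
   one side of which is not minimal.  A circuit of length 6 has a chord which is
   again a lattice point: the only obstruction is nonnegativity of row 0, which
   leaves out all three chords only for a translate of B_3 when the sum of row 0
   is 1.  The bilinear form is chosen so that a pair of vertices of the hexagon
   can then always be improved by means of a chord. *)
Require Import Defs.
From mathcomp Require Import all_boot all_order all_algebra.
From mathcomp Require Import fraction mpoly.
From mathcomp Require Import reals.
From mathcomp Require Import perm zify ring.
Set Implicit Arguments.
Unset Strict Implicit.
Unset Printing Implicit Defensive.
Import Order.TTheory GRing.Theory Num.Theory.
Local Open Scope ring_scope.

(** * Term orders refined by weights *)

Definition monomial_weight N (w : 'I_N -> nat) (m : 'X_{1..N}) : nat :=
  (\sum_u m u * w u)%N.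

Lemma monomial_weightD N (w : 'I_N -> nat) (m1 m2 : 'X_{1..N}) :
  monomial_weight w (m1 + m2)%MM =
  (monomial_weight w m1 + monomial_weight w m2)%N.
Proof.
by rewrite /monomial_weight -big_split; apply: eq_bigr => u _; rewrite mnmDE mulnDl.
Qed.

Lemma monomial_weight0 N (w : 'I_N -> nat) : monomial_weight w 0%MM = 0%N.
Proof. by rewrite /monomial_weight big1 // => u _; rewrite mnm0E. Qed.

Lemma monomial_weightU N (w : 'I_N -> nat) u : monomial_weight w U_(u)%MM = w u.
Proof.
rewrite /monomial_weight (bigD1 u) //= mnm1E eqxx mul1n big1 ?addn0 // => v.
by rewrite mnm1E eq_sym => /negPf->.
Qed.

Definition weight_order N (w : 'I_N -> nat) (le : rel 'X_{1..N}) :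
    rel 'X_{1..N} :=
  fun m1 m2 => (monomial_weight w m1 < monomial_weight w m2)%N ||
    (monomial_weight w m1 == monomial_weight w m2) && le m1 m2.

Lemma term_order_weight N (w : 'I_N -> nat) (le : rel 'X_{1..N}) :
  term_order le -> term_order (weight_order w le).
Proof.
case=> le_refl le_anti le_trans le_total [le0 leD]; rewrite /weight_order.
split=> [m|m1 m2|m2 m1 m3|m1 m2|].
- by rewrite eqxx le_refl orbT.
- by case: ltngtP => //= _; apply: le_anti.
- case: ltngtP => //= [lt12 _|-> le12].
    by case: ltngtP => //= [lt23 _|<- _]; rewrite ?lt12 // (ltn_trans lt12 lt23).
  by case: ltngtP => //= _ /(le_trans _ _ _ le12).
- by case: ltngtP => //= _; apply: le_total.
- split=> [m|m1 m2 m].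
    by rewrite monomial_weight0 le0 andbT orbC -leq_eqVlt.
  by rewrite !monomial_weightD ltn_add2r eqn_add2r => /orP[->//|/andP[-> /leD->]];
    rewrite orbT.
Qed.

Lemma term_order_mnmc N : term_order (@mnmc_le N).
Proof.
split.
- by move=> m; apply: (@Order.POrderTheory.lexx _ 'X_{1..N}).
- by move=> m1 m2; apply: (@Order.POrderTheory.le_anti _ 'X_{1..N}).
- by move=> m2 m1 m3; apply: (@Order.POrderTheory.le_trans _ 'X_{1..N}).
- exact: lemc_total.
- split=> [m|m1 m2 m]; first exact: (@le0x _ 'X_{1..N}).
  by rewrite -[mnmc_le (_ + _)%MM _]/((m1 + m)%MM <= (m2 + m)%MM)%O lemc_add2l.
Qed.

(** * Toric ideals and a criterion for quadratic initial ideals *)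

Section ToricGroebner.
Variables (k : fieldType) (d N : nat) (a : 'I_N -> 'rV[int]_d).
Hypothesis a_ge0 : forall u j, 0 <= a u 0 j.
Implicit Types m : 'X_{1..N}.

Definition same_fiber m1 m2 :=
  (mdeg m1 == mdeg m2) && (\sum_u a u *+ m1 u == \sum_u a u *+ m2 u).

(** Coordinates are nonnegative, so a variable maps to a genuine monomial and absolute values lose
    nothing. Index [ord0] stands for t_0: there [unlift] gives [None] and the exponent is 1. *)
Definition point_exponent u : 'X_{1..d.+1} :=
  [multinom oapp (fun j => `|a u 0%R j|%N) 1%N (unlift ord0 i) | i < d.+1].

Definition fiber_exponent m : 'X_{1..d.+1} :=
  (\sum_u point_exponent u *+ m u)%MM.

Lemma same_fiberE m1 m2 :
  same_fiber m1 m2 = (fiber_exponent m1 == fiber_exponent m2).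
Proof.
have E0 m : fiber_exponent m ord0 = mdeg m.
  rewrite mnm_sumE mdegE; apply: eq_bigr => u _.
  by rewrite mulmnE mnmE unlift_none mul1n.
have Ej m j : (fiber_exponent m (lift ord0 j))%:Z = (\sum_u a u *+ m u) 0 j.
  rewrite mnm_sumE summxE -natz natr_sum; apply: eq_bigr => u _.
  rewrite mulmnE mnmE liftK /= mulmxnE natz PoszM gez0_abs //.
  by rewrite -mulr_natr natz.
apply/andP/eqP => [[/eqP dm /eqP am]|Em].
  apply/mnmP => i; case: (unliftP ord0 i) => [j|] ->; last by rewrite !E0.
  by apply/eqP; rewrite -eqz_nat !Ej am.
split; first by rewrite -!E0 Em.
by apply/eqP/rowP => j; rewrite -!Ej Em.
Qed.

Lemma toric_monomialE u :
  toric_monomial k (a u) = tofrac ('X_[point_exponent u] : {mpoly k[d.+1]}).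
Proof.
rewrite mpolyXE_id rmorph_prod big_ord_recl /toric_monomial; congr (_ * _).
  by rewrite mnmE unlift_none.
apply: eq_bigr => j _; rewrite mnmE liftK /= rmorphXn /= -/(toric_var k _).
by rewrite -[in LHS](gez0_abs (a_ge0 u j)).
Qed.

Definition toric_poly : {mpoly k[N]} -> {mpoly k[d.+1]} :=
  mmap (@mpolyC d.+1 k) (fun u => 'X_[point_exponent u]).

Lemma toric_mapE (p : {mpoly k[N]}) : toric_map a p = tofrac (toric_poly p).
Proof.
rewrite /toric_poly rmorph_sum; apply: eq_bigr => m _ /=.
rewrite rmorphM /=; congr (_ * _); rewrite /mmap1 rmorph_prod.
by apply: eq_bigr => u _; rewrite toric_monomialE rmorphXn.
Qed.

Lemma mmap1_point_exponent m :
  mmap1 (fun u => 'X_[point_exponent u]) m = 'X_[k, fiber_exponent m].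
Proof.
rewrite /mmap1 /fiber_exponent (big_morph _ (@mpolyXD _ _) (@mpolyX0 _ _)).
by apply: eq_bigr => u _; rewrite mpolyXn.
Qed.

Lemma toric_ideal_binomial m1 m2 :
  same_fiber m1 m2 -> toric_ideal k a ('X_[m1] - 'X_[m2]).
Proof.
rewrite same_fiberE => /eqP E12.
rewrite /toric_ideal toric_mapE /toric_poly mmapB !mmapX !mmap1_point_exponent.
by rewrite E12 subrr rmorph0.
Qed.

(** The coefficient of the image of [p] at [fiber_exponent m] is the sum of the coefficients of [p]
    over the fibre of [m]. It vanishes, so [m] cannot be alone there. *)
Lemma toric_ideal_fiber (p : {mpoly k[N]}) m :
  toric_ideal k a p -> m \in msupp p ->
  exists2 m', m' \in msupp p & (m' != m) && same_fiber m m'.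
Proof.
rewrite /toric_ideal toric_mapE => /eqP.
rewrite tofrac_eq0 => /eqP/(congr1 (mcoeff (fiber_exponent m))).
rewrite mcoeff0 raddf_sum /=.
under eq_bigr do rewrite mmap1_point_exponent mul_mpolyC.
move=> sum0 mp.
have [/hasP[m' m'p Pm']|/hasPn none] :=
  boolP (has (fun m' => (m' != m) && same_fiber m m') (msupp p)).
  by exists m'.
move: (mp); rewrite mcoeff_msupp => /negP[]; apply/eqP.
rewrite -[RHS]sum0 (bigD1_seq m) ?msupp_uniq //=.
rewrite mcoeffZ mcoeffX eqxx mulr1 big_seq_cond big1 ?addr0 //=.
move=> m' /andP[m'p nm]; rewrite mcoeffZ mcoeffX.
by have := none _ m'p; rewrite nm same_fiberE eq_sym /= => /negPf->; rewrite mulr0.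
Qed.

Variable le : rel 'X_{1..N}.
Hypothesis le_term : term_order le.

Definition pair_minimal u v :=
  [forall u', forall v', (a u + a v == a u' + a v') ==>
    le (U_(u) + U_(v))%MM (U_(u') + U_(v'))%MM].

Definition pairwise_minimal m :=
  forall u v, (U_(u) + U_(v) <= m)%MM -> pair_minimal u v.

Lemma same_fiber_pair u v u' v' :
  same_fiber (U_(u) + U_(v))%MM (U_(u') + U_(v'))%MM = (a u + a v == a u' + a v').
Proof.
rewrite /same_fiber !mdegD !mdeg1 eqxx /=.
suff E w x : \sum_i a i *+ (U_(w) + U_(x))%MM i = a w + a x by rewrite !E.
under eq_bigr do rewrite mnmDE mulrnDr.
rewrite big_split /=; congr (_ + _).
  rewrite (bigD1 w) //= mnm1E eqxx mulr1n big1 ?addr0 // => i.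
  by rewrite mnm1E eq_sym => /negPf->; rewrite mulr0n.
rewrite (bigD1 x) //= mnm1E eqxx mulr1n big1 ?addr0 // => i.
by rewrite mnm1E eq_sym => /negPf->; rewrite mulr0n.
Qed.

(** A fibre has constant degree, hence is finite: [s] lists it, and a total order has a least
    element on a nonempty list. *)
Lemma fiber_minimum m :
  exists2 m0, same_fiber m m0 & forall m', same_fiber m m' -> le m0 m'.
Proof.
case: le_term => le_refl _ le_trans le_total _.
have min_seq (s : seq 'X_{1..N}) : s != [::] ->
    exists2 m0, m0 \in s & {in s, forall m', le m0 m'}.
  elim: s => // x [_ _|y s /(_ isT)[m0 m0s m0P] _].
    by exists x; rewrite ?mem_head // => m'; rewrite inE => /eqP->.
  have /orP[lex|lex] := le_total x m0.
    exists x; rewrite ?mem_head // => m'; rewrite inE => /orP[/eqP->//|/m0P].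
    exact: le_trans.
  exists m0; first by rewrite inE m0s orbT.
  by move=> m'; rewrite inE => /orP[/eqP->//|/m0P].
pose s := 
  [seq bmnm x | x in [pred x : 'X_{1..N < (mdeg m).+1} | same_fiber m (bmnm x)]].
have sP m' : (m' \in s) = same_fiber m m'.
  apply/imageP/idP => [[x xm ->]//|mm'].
  have lt_m' : (mdeg m' < (mdeg m).+1)%N by case/andP: mm' => /eqP->.
  by exists (BMultinom lt_m').
have [|m0] := min_seq s.
  have : m \in s by rewrite sP /same_fiber !eqxx.
  by case: s {sP}.
by rewrite sP => mm0 m0P; exists m0 => // m' mm'; apply: m0P; rewrite sP.
Qed.

Lemma same_fiberD m1 m2 m : same_fiber m1 m2 -> same_fiber (m1 + m) (m2 + m).
Proof.
have E m' : \sum_u a u *+ (m' + m)%MM u = \sum_u a u *+ m' u + \sum_u a u *+ m u.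
  by rewrite -big_split; apply: eq_bigr => u _; rewrite mnmDE mulrnDr.
by rewrite /same_fiber !mdegD eqn_add2r !E => /andP[-> /eqP->]; rewrite eqxx.
Qed.

(** Replacing a factor of degree 2 by a smaller one in its fibre stays in the fibre of [m] and
    lowers [m], by compatibility with products. *)
Lemma minimum_pairwise_minimal m :
  (forall m', same_fiber m m' -> le m m') -> pairwise_minimal m.
Proof.
case: le_term => _ le_anti _ le_total [_ leD] m_min u v uv_m.
apply/forallP => u'; apply/forallP => v'; apply/implyP => uv.
have /orP[//|le'] := le_total (U_(u) + U_(v))%MM (U_(u') + U_(v'))%MM.
suff -> : (U_(u) + U_(v) = U_(u') + U_(v'))%MM by case: le_term.
have := leD _ _ (m - (U_(u) + U_(v)))%MM le'.
rewrite [X in le _ X]addmC submK // => le1.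
have /m_min le2 : same_fiber m (U_(u') + U_(v') + (m - (U_(u) + U_(v))))%MM.
  rewrite -{1}(submK uv_m) addmC; apply: same_fiberD.
  by rewrite same_fiber_pair.
have := le_anti _ _ (introT andP (conj le1 le2)).
by rewrite -{2}(submK uv_m) addmC => /addmI.
Qed.

(** The generators are the nonminimal pairs, squarefree by the first hypothesis. An initial monomial
    divisible by none of them would be pairwise minimal, hence by uniqueness the minimum of its
    fibre. *)
Lemma pairwise_minimal_groebner :
  (forall u, pair_minimal u u) ->
  (forall m1 m2, pairwise_minimal m1 -> pairwise_minimal m2 ->
    same_fiber m1 m2 -> m1 = m2) ->
  has_squarefree_quadratic_initial_ideal (toric_ideal k a).
Proof.
case: (le_term) => le_refl le_anti le_trans le_total _ sq_min uniq_min.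
pose s := [seq uv : 'I_N * 'I_N <- enum {: 'I_N * 'I_N} |
  ~~ pair_minimal uv.1 uv.2].
pose G := [seq (U_(uv.1) + U_(uv.2))%MM | uv <- s].
have GP u v : ~~ pair_minimal u v -> (U_(u) + U_(v))%MM \in G.
  by move=> nuv; apply/mapP; exists (u, v); rewrite // mem_filter mem_enum andbT.
exists le; split=> //; exists G; split.
  apply/allP => m /mapP[[u v]]; rewrite mem_filter => /andP[/= nuv _] ->.
  rewrite /squarefree_quadratic mdegD !mdeg1 eqxx; apply/forallP => i.
  rewrite mnmDE !mnm1E; case: (altP (u =P i)) => [ui|_]; last by case: (v == i).
  by case: (altP (v =P i)) => // vi; move: nuv; rewrite ui vi sq_min.
move=> p; rewrite /initial_ideal /ideal_generated.
split=> [[t [tP ->]]|[t [tP ->]]]; last first.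
  exists t; split=> // x /tP[m /mapP[[u v]]].
  rewrite mem_filter => /andP[/= nuv _] -> ->.
  move: nuv => /forallPn[u' /forallPn[v']]; rewrite negb_imply => /andP[uv nle].
  have le' : le (U_(u') + U_(v'))%MM (U_(u) + U_(v))%MM.
    by case/orP: (le_total (U_(u) + U_(v))%MM (U_(u') + U_(v'))%MM) nle => ->.
  have neq : (U_(u') + U_(v') != U_(u) + U_(v))%MM.
    by apply: contraNneq nle => ->.
  exists ('X_[U_(u) + U_(v)] - 'X_[U_(u') + U_(v')]), (U_(u) + U_(v))%MM.
  split=> //; first by apply: toric_ideal_binomial; rewrite same_fiber_pair.
  rewrite /initial_monomial mcoeff_msupp mcoeffB !mcoeffX eqxx (negPf neq).
  rewrite subr0 oner_neq0 /=; apply/allP => m'.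
  rewrite mcoeff_msupp mcoeffB !mcoeffX.
  case: (_ =P m') => [<- _|_]; first exact: le_refl.
  by case: (_ =P m') => [<- _|_]; rewrite ?subrr ?eqxx.
have divG x : x \in t -> exists2 g, g \in G & exists q, x.2 = q * 'X_[g].
  move=> /tP[f [m [If /andP[mf /allP m_max] ->]]].
  suff [u [v [uv_m nuv]]] : exists u v, (U_(u) + U_(v) <= m)%MM /\ ~~ pair_minimal u v.
    exists (U_(u) + U_(v))%MM; first exact: GP.
    by exists 'X_[m - (U_(u) + U_(v))]; rewrite -mpolyXD submK.
  have [/existsP[u /existsP[v /andP[uvm nuv]]]|] :=
    boolP [exists u, exists v, (U_(u) + U_(v) <= m)%MM && ~~ pair_minimal u v].
    by exists u, v.
  rewrite negb_exists => /forallP none.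
  have m_pm : pairwise_minimal m.
    move=> u v uvm; have := none u; rewrite negb_exists => /forallP/(_ v).
    by rewrite uvm negbK.
  have [m0 mm0 m0P] := fiber_minimum m.
  have m0_eq : m = m0.
    apply: uniq_min => //; apply: minimum_pairwise_minimal => m' m0m'.
    by apply: m0P; move: mm0 m0m'; rewrite !same_fiberE => /eqP-> /eqP->.
  (* The other monomial [m'] of [f] in this fibre is below [m], as [m] is initial, and above it, as
     [m] is the minimum of the fibre. *)
  have [m' m'f /andP[/eqP nm mm']] := toric_ideal_fiber If mf.
  case: nm; apply: le_anti; rewrite m_max //= m0_eq.
  exact: m0P.
elim: t divG {tP} => [|x t IH] divG.
  by exists [::]; split=> //; rewrite !big_nil.
have [y yt|t' [t'P Et]] := IH; first by apply: divG; rewrite inE yt orbT.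
have [|g gG [q Eq]] := divG x; first exact: mem_head.
exists ((x.1 * q, 'X_[g]) :: t'); split.
  by move=> y; rewrite inE => /orP[/eqP->/=|/t'P//]; exists g.
by rewrite !big_cons Et Eq /= mulrA.
Qed.

End ToricGroebner.

(** * Indices and sums over three elements *)

Definition o0 : 'I_3 := @Ordinal 3 0 isT.
Definition o1 : 'I_3 := @Ordinal 3 1 isT.
Definition o2 : 'I_3 := @Ordinal 3 2 isT.

Lemma ord3P (P : 'I_3 -> Prop) : P o0 -> P o1 -> P o2 -> forall i, P i.
Proof.
move=> P0 P1 P2 [[|[|[|//]]] lti].
- by rewrite (_ : Ordinal lti = o0) //; apply: val_inj.
- by rewrite (_ : Ordinal lti = o1) //; apply: val_inj.
- by rewrite (_ : Ordinal lti = o2) //; apply: val_inj.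
Qed.

Lemma big_ord3 (f : 'I_3 -> int) : \sum_i f i = f o0 + f o1 + f o2.
Proof.
rewrite !big_ord_recl big_ord0 addr0 addrA.
by congr (f _ + f _ + f _); apply: val_inj.
Qed.

Lemma ord3_cover (i l m : 'I_3) : uniq [:: i; l; m] ->
  forall p, [\/ p = i, p = l | p = m].
Proof.
by elim/ord3P: i; elim/ord3P: l; elim/ord3P: m => //= _ p; elim/ord3P: p;
  try (by constructor 1); try (by constructor 2); constructor 3.
Qed.

Lemma ord3_third (i l : 'I_3) : i != l -> exists m, uniq [:: i; l; m].
Proof.
by elim/ord3P: i; elim/ord3P: l => // _;
  try (by exists o0); try (by exists o1); exists o2.
Qed.

Lemma sum_ord3 (f : 'I_3 -> int) i l m : uniq [:: i; l; m] ->
  \sum_p f p = f i + f l + f m.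
Proof.
by rewrite big_ord3; elim/ord3P: i; elim/ord3P: l; elim/ord3P: m => //= _; ring.
Qed.

(** * Integer 3 x 3 matrices with zero line sums *)

Section Circulation.
Variable D : 'I_3 -> 'I_3 -> int.
Hypothesis D_row : forall i, \sum_j D i j = 0.
Hypothesis D_col : forall j, \sum_i D i j = 0.

(** A positive entry forces a negative one in its row, at [l], and in its column, at [m]. If [D m l]
    is not positive, zero line sums make [D m l'] and [D m' l] positive; then a negative [D m' j] or
    [D i l'] closes a 4-cycle, and otherwise [D m' l'] is negative and closes a 6-cycle. *)
Lemma circulation_cycle i j : 0 < D i j ->
  exists m m' l l', [/\ uniq [:: i; m; m'], uniq [:: j; l; l'], D i l < 0, D m j < 0 &
    0 < D m l \/ [/\ 0 < D m' l, D m' l' < 0 & 0 < D m l']].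
Proof.
move=> Dij.
have neg_col p q : 0 < D p q -> exists2 x, q != x & D p x < 0.
  move=> Dpq; have := D_row p; rewrite big_ord3.
  elim/ord3P: q Dpq => Dpq D0.
  - by (have [|] : D p o1 < 0 \/ D p o2 < 0 by lia); [exists o1|exists o2].
  - by (have [|] : D p o0 < 0 \/ D p o2 < 0 by lia); [exists o0|exists o2].
  - by (have [|] : D p o0 < 0 \/ D p o1 < 0 by lia); [exists o0|exists o1].
have neg_row p q : 0 < D p q -> exists2 x, p != x & D x q < 0.
  move=> Dpq; have := D_col q; rewrite big_ord3.
  elim/ord3P: p Dpq => Dpq D0.
  - by (have [|] : D o1 q < 0 \/ D o2 q < 0 by lia); [exists o1|exists o2].
  - by (have [|] : D o0 q < 0 \/ D o2 q < 0 by lia); [exists o0|exists o2].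
  - by (have [|] : D o0 q < 0 \/ D o1 q < 0 by lia); [exists o0|exists o1].
have [l jl Dil] := neg_col _ _ Dij; have [l' Ul] := ord3_third jl.
have [m im Dmj] := neg_row _ _ Dij; have [m' Um] := ord3_third im.
have := D_row i; have := D_row m; have := D_row m'.
rewrite !(sum_ord3 _ Ul) => Rm' Rm Ri.
have := D_col j; have := D_col l; have := D_col l'.
rewrite !(sum_ord3 _ Um) => Cl' Cl Cj.
have Um2 : uniq [:: i; m'; m].
  by move: Um; rewrite /= !inE !negb_or [m' == m]eq_sym -!andbA => /and4P[-> -> ->].
have Ul2 : uniq [:: j; l'; l].
  by move: Ul; rewrite /= !inE !negb_or [l' == l]eq_sym -!andbA => /and4P[-> -> ->].
have [Dml|Dml] := ltP 0 (D m l); first by exists m, m', l, l'; split=> //; left.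
have [Dm'j|Dm'j] := ltP (D m' j) 0.
  by exists m', m, l, l'; split=> //; left; lia.
have [Dil'|Dil'] := ltP (D i l') 0.
  by exists m, m', l', l; split=> //; left; lia.
by exists m, m', l, l'; split=> //; right; split; lia.
Qed.

(** [C] is the alternating indicator of the cycle of [circulation_cycle]; it conforms to [D] because
    nonzero integers have absolute value at least 1. *)
Lemma conformal_circuit i j : 0 < D i j ->
  exists C : 'I_3 -> 'I_3 -> int,
  [/\ forall p, \sum_q C p q = 0, forall q, \sum_p C p q = 0, C i j = 1 &
    forall p q, C p q = 0 \/ C p q = 1 /\ 1 <= D p q \/ C p q = -1 /\ D p q <= -1].
Proof.
move=> Dij; have [m [m' [l [l' [Um Ul Dil Dmj cycle]]]]] := circulation_cycle Dij.
have := Um; rewrite /= !inE !negb_or -!andbA => /and4P[im im' mm' _].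
have := Ul; rewrite /= !inE !negb_or -!andbA => /and4P[jl jl' ll' _].
pose b (x : bool) : int := x%:Z.
have neqs := (negPf im, negPf im', negPf mm', negPf jl, negPf jl', negPf ll').
have neqs' : ((m == i) = false) * ((m' == i) = false) * ((m' == m) = false) *
   ((l == j) = false) * ((l' == j) = false) * ((l' == l) = false).
  by rewrite !(eq_sym _ i) !(eq_sym _ j) (eq_sym m') (eq_sym l') !neqs.
case: cycle => [Dml|[Dm'l Dm'l' Dml']].
- exists (fun p q => (b (p == i) - b (p == m)) * (b (q == j) - b (q == l))).
  split=> [p|q||p q].
  + by rewrite (sum_ord3 _ Ul) !eqxx !neqs !neqs' /b /=; ring.
  + by rewrite (sum_ord3 _ Um) !eqxx !neqs !neqs' /b /=; ring.
  + by rewrite !eqxx !neqs /b /=; ring.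
  + by case: (ord3_cover Um p) => ->; case: (ord3_cover Ul q) => ->;
      rewrite ?eqxx ?neqs ?neqs' /b /=; clear -Dij Dil Dmj Dml; lia.
- exists (fun p q => b (p == i) * (b (q == j) - b (q == l)) +
    b (p == m') * (b (q == l) - b (q == l')) + b (p == m) * (b (q == l') - b (q == j))).
  split=> [p|q||p q].
  + by rewrite (sum_ord3 _ Ul) !eqxx !neqs !neqs' /b /=; ring.
  + by rewrite (sum_ord3 _ Um) !eqxx !neqs !neqs' /b /=; ring.
  + by rewrite !eqxx !neqs /b /=; ring.
  + by case: (ord3_cover Um p) => ->; case: (ord3_cover Ul q) => ->;
      rewrite ?eqxx ?neqs ?neqs' /b /=;
      clear -Dij Dil Dmj Dm'l Dm'l' Dml'; lia.
Qed.

End Circulation.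

(** * The weight on chords of a hexagon *)

(* Found by computer search among the weights satisfying hexagon_descent. *)
Definition chord_weight (i j : nat) : int :=
  match i, j with 1, 0 => 2 | 1, 2 => 1 | 2, 1 => 1 | _, _ => 0 end%N.

(* The hexagon has vertices (a1, b1), (a1, b2), (a2, b2), (a2, b3), (a3, b3),
   (a3, b1).  Its chord (a1, b3) is known to be a lattice point unless the two
   triangles have the same orientation and a1 = b3 differs from some index d
   with row 0 large enough. *)
Definition chord_descent (same : bool) (d a1 a2 a3 b1 b2 b3 : nat) : bool :=
  let w i j := if same then chord_weight i j else - chord_weight i j in
  [|| ~~ same, a1 != b3 | a1 == d] &&
  ((w a1 b3 + w a3 b1 < w a1 b1 + w a3 b3) || (w a1 b3 + w a2 b2 < w a1 b2 + w a2 b3)).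

(** The three alternatives are the three chords, permuted by rotating the hexagon. The whole claim
    is a finite check, done by evaluation. *)
Lemma hexagon_descent (same : bool) (d a1 a2 a3 b1 b2 b3 : 'I_3) :
  uniq [:: a1; a2; a3] -> uniq [:: b1; b2; b3] ->
  [|| chord_descent same d a1 a2 a3 b1 b2 b3, chord_descent same d a2 a3 a1 b2 b3 b1
    | chord_descent same d a3 a1 a2 b3 b1 b2].
Proof.
pose I := iota 0 3.
have check : all (fun same => all (fun d => all (fun a1 => all (fun a2 => all (fun a3 =>
    all (fun b1 => all (fun b2 => all (fun b3 =>
      uniq [:: a1; a2; a3] ==> uniq [:: b1; b2; b3] ==>
      [|| chord_descent same d a1 a2 a3 b1 b2 b3, chord_descent same d a2 a3 a1 b2 b3 b1
        | chord_descent same d a3 a1 a2 b3 b1 b2]) I) I) I) I) I) I) I) [:: true; false].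
  by vm_compute.
have inI (i : 'I_3) : (i : nat) \in I by rewrite /I mem_iota ltn_ord.
move: check => /allP/(_ same).
have -> : same \in [:: true; false] by case: same.
move=> /(_ isT)/allP/(_ _ (inI d))/allP/(_ _ (inI a1))/allP/(_ _ (inI a2)).
move=> /allP/(_ _ (inI a3))/allP/(_ _ (inI b1))/allP/(_ _ (inI b2)).
by move=> /allP/(_ _ (inI b3))/implyP check Ua Ub; move/implyP: (check Ua); apply.
Qed.

(** * Locating the points of a monomial in a simplex cell *)

(** If a value were below the floor of the mean, all values would be at most that floor and the mean
    would drop below it; the upper bound is symmetric. *)
Lemma floor_bounds N (m : 'X_{1..N}) (g : 'I_N -> int) :
  (forall u v, (0 < m u)%N -> (0 < m v)%N -> g u - g v <= 1) ->
  forall u, (0 < m u)%N ->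
  ((\sum_v g v * (m v)%:Z) %/ (mdeg m)%:Z)%Z <= g u <=
    ((\sum_v g v * (m v)%:Z) %/ (mdeg m)%:Z)%Z + 1.
Proof.
move=> g_close u mu; set S := \sum_v _; set n := (mdeg m)%:Z.
have n_gt0 : 0 < n.
  by rewrite ltz_nat mdegE (bigD1 u) //= addn_gt0 mu.
have := divz_eq S n; have := modz_ge0 S (lt0r_neq0 n_gt0); have := ltz_pmod S n_gt0.
set f := (S %/ n)%Z; set rho := (S %% n)%Z => rho_lt rho_ge0 ES.
have shift t : S - t * n = \sum_v (g v - t) * (m v)%:Z.
  under [RHS]eq_bigr do rewrite mulrBl.
  rewrite sumrB -mulr_sumr; congr (_ - _ * _).
  by rewrite /n mdegE -natz natr_sum; apply: eq_bigr => v _; rewrite natz.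
apply/andP; split; rewrite leNgt; apply/negP => gu.
  have : S - f * n < 0; last by lia.
  rewrite shift (bigD1 u) //= -[ltRHS]addr0 ltr_leD //.
    by rewrite pmulr_llt0 ?subr_lt0 ?ltz_nat.
  apply: sumr_le0 => v _; have [->|mv] := posnP (m v); first by rewrite mulr0.
  by rewrite pmulr_lle0 ?ltz_nat //; have := g_close v u mv mu; lia.
have : 0 < S - (f + 1) * n; last by lia.
rewrite shift (bigD1 u) //= -[ltLHS]addr0 ltr_leD //.
  by rewrite pmulr_lgt0 ?subr_gt0 ?ltz_nat.
apply: sumr_ge0 => v _; have [->|mv] := posnP (m v); first by rewrite mulr0.
by rewrite pmulr_lge0 ?ltz_nat //; have := g_close u v mu mv; lia.
Qed.

(** A plane of constant coordinate sum cuts the lattice points of a unit cube in a triangle, an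
    opposite triangle or a single vertex, according to the excess [T] of the sum over that of
    [f]. *)
Lemma simplex_cell N (P : pred 'I_N) (g : 'I_N -> 'I_3 -> int) (f : 'I_3 -> int) t :
  (forall u j, P u -> f j <= g u j <= f j + 1) ->
  (forall u, P u -> \sum_j g u j = t) ->
  exists (y : 'I_3 -> int) s (p : 'I_N -> 'I_3), (s = 1 \/ s = -1) /\
    forall u j, P u -> g u j = y j + (if j == p u then s else 0).
Proof.
move=> gf gt.
have bnd u : P u -> [/\ f o0 <= g u o0 <= f o0 + 1, f o1 <= g u o1 <= f o1 + 1,
    f o2 <= g u o2 <= f o2 + 1 & g u o0 + g u o1 + g u o2 = t].
  by move=> Pu; rewrite !gf // -big_ord3 gt.
pose T := t - (f o0 + f o1 + f o2).
(* For [T] equal to 1 this picks the only raised coordinate ([v] is 1), for [T] equal to 2 the only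
   one not raised ([v] is 0). *)
pose p v u := if g u o0 == f o0 + v then o0 else if g u o1 == f o1 + v then o1 else o2.
have [T1|T1] := eqVneq T 1.
  exists f, 1, (p 1); split; first by left.
  move=> u j /bnd[]; rewrite /p; move: T1; rewrite /T.
  case: (g u o0 =P f o0 + 1) => ?; last case: (g u o1 =P f o1 + 1) => ?;
    by elim/ord3P: j => /=; lia.
have [T2|T2] := eqVneq T 2.
  exists (fun j => f j + 1), (-1), (p 0); split; first by right.
  move=> u j /bnd[]; rewrite /p; move: T2; rewrite /T.
  case: (g u o0 =P f o0 + 0) => ?; last case: (g u o1 =P f o1 + 0) => ?;
    by elim/ord3P: j => /=; lia.
(* Now [T] is 0 or 3, unless [P] is empty, and the cell is one point. It is presented as vertex [o0]
   of a triangle, whence the 1 subtracted there. *)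
pose v : int := if T == 0 then 0 else 1.
exists (fun j => f j + v - (if j == o0 then 1 else 0)), 1, (fun => o0); split; first by left.
move=> u j /bnd[]; move: T1 T2; rewrite /v /T.
by case: (t - _ =P 0) => ? ? ?; elim/ord3P: j => /=; lia.
Qed.

(** * The term order of a transportation polytope and its minimal pairs *)

Section Transportation.
Variables (d N : nat) (a : 'I_N -> 'rV[int]_d) (e : 'I_3 -> 'I_3 -> 'I_d).
Variables (r c : 'I_3 -> int).
Local Notation X u i j := (a u 0 (e i j)).
Hypothesis a_inj : injective a.
Hypothesis e_surj : forall q, exists i j, q = e i j.
Hypothesis X_ge0 : forall u i j, 0 <= X u i j.
Hypothesis X_row : forall u i, \sum_j X u i j = r i.
Hypothesis X_col : forall u j, \sum_i X u i j = c j.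
Hypothesis X_surj : forall f : 'I_3 -> 'I_3 -> int, (forall i j, 0 <= f i j) ->
  (forall i, \sum_j f i j = r i) -> (forall j, \sum_i f i j = c j) ->
  exists u, forall i j, X u i j = f i j.
Hypothesis r0_ge2 : 2 <= r o0.

Definition square_weight u : nat :=
  (\sum_j `|X u o1 j| ^ 2 + \sum_j `|X u o2 j| ^ 2)%N.

(* The value of \sum_(i, j) chord_weight i j * X u o1 i * X u o2 j. *)
Definition bilinear_weight u : nat :=
  (`|X u o1 o1| * (2 * `|X u o2 o0| + `|X u o2 o2|) + `|X u o1 o2| * `|X u o2 o1|)%N.

Definition transport_order : rel 'X_{1..N} :=
  weight_order square_weight (weight_order bilinear_weight (@mnmc_le N)).

Lemma term_order_transport : term_order transport_order.
Proof. by do 2!apply: term_order_weight; apply: term_order_mnmc. Qed.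

Lemma square_weightE u : (square_weight u)%:Z =
  X u o1 o0 ^+ 2 + X u o1 o1 ^+ 2 + X u o1 o2 ^+ 2 +
  (X u o2 o0 ^+ 2 + X u o2 o1 ^+ 2 + X u o2 o2 ^+ 2).
Proof.
have sumE (g : 'I_3 -> int) : (\sum_j `|g j| ^ 2)%N%:Z = \sum_j g j ^+ 2.
  rewrite -natz natr_sum; apply: eq_bigr => j _.
  by rewrite natz -abszX gez0_abs // sqr_ge0.
by rewrite /square_weight PoszD !sumE !big_ord3.
Qed.

Lemma bilinear_weightE u : (bilinear_weight u)%:Z =
  X u o1 o1 * (2 * X u o2 o0 + X u o2 o2) + X u o1 o2 * X u o2 o1.
Proof. by rewrite /bilinear_weight !(PoszD, PoszM) !gez0_abs. Qed.

Lemma row0E u j : X u o0 j = c j - X u o1 j - X u o2 j.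
Proof. by rewrite -(X_col u) big_ord3; ring. Qed.

Lemma point_inj u v :
  (forall j, X u o1 j = X v o1 j) -> (forall j, X u o2 j = X v o2 j) -> u = v.
Proof.
move=> E1 E2; apply: a_inj; apply/rowP => q; have [i [j ->]] := e_surj q.
by elim/ord3P: i; rewrite ?row0E ?E1 ?E2.
Qed.

Lemma pair_sumP u v u' v' :
  (forall j, X u o1 j + X v o1 j = X u' o1 j + X v' o1 j) ->
  (forall j, X u o2 j + X v o2 j = X u' o2 j + X v' o2 j) ->
  a u + a v = a u' + a v'.
Proof.
move=> E1 E2; apply/rowP => q; have [i [j ->]] := e_surj q; rewrite !mxE.
elim/ord3P: i; rewrite ?E1 ?E2 // !row0E.
by have := E1 j; have := E2 j; lia.
Qed.

Lemma pair_minimal_weight u v u' v' : pair_minimal a transport_order u v ->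
  a u + a v = a u' + a v' ->
  (square_weight u)%:Z + (square_weight v)%:Z <
    (square_weight u')%:Z + (square_weight v')%:Z \/
  (square_weight u)%:Z + (square_weight v)%:Z =
    (square_weight u')%:Z + (square_weight v')%:Z /\
  (bilinear_weight u)%:Z + (bilinear_weight v)%:Z <=
    (bilinear_weight u')%:Z + (bilinear_weight v')%:Z.
Proof.
move=> /forallP/(_ u')/forallP/(_ v')/implyP + E.
rewrite E eqxx => /(_ isT).
rewrite /transport_order /weight_order !monomial_weightD !monomial_weightU.
move=> /orP[lt|/andP[/eqP eq1 /orP[lt|/andP[/eqP eq2 _]]]].
- by left; rewrite -!PoszD ltz_nat.
- by right; rewrite -!PoszD eq1; split=> //; rewrite lez_nat ltnW.
- by right; rewrite -!PoszD eq1 eq2.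
Qed.

(** Strict convexity: if u' + v' = 2u, the squares of u' and v' exceed twice those of u by twice the
    square of u - v'. So the weight grows unless u' = v' = u. *)
Lemma pair_minimal_square u : pair_minimal a transport_order u u.
Proof.
apply/forallP => u'; apply/forallP => v'; apply/implyP => /eqP E.
have Eij i j : X u i j + X u i j = X u' i j + X v' i j.
  by have := congr1 (fun x : 'rV_d => x 0 (e i j)) E; rewrite !mxE.
have [lt|ge] := ltnP (square_weight u + square_weight u)%N
                     (square_weight u' + square_weight v')%N.
  by rewrite /transport_order /weight_order !monomial_weightD !monomial_weightU lt.
pose F i j := X u' i j ^+ 2 + X v' i j ^+ 2; pose H i j := X u i j ^+ 2.
pose S i j := (X u i j - X v' i j) ^+ 2.
have FE i j : F i j = 2 * H i j + 2 * S i j.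
  have -> : F i j = (X u i j + X u i j - X v' i j) ^+ 2 + X v' i j ^+ 2.
    by rewrite /F Eij; ring.
  by rewrite /H /S; ring.
have S_ge0 i j : 0 <= S i j by apply: sqr_ge0.
have sumS : F o1 o0 + F o1 o1 + F o1 o2 + (F o2 o0 + F o2 o1 + F o2 o2) <=
    2 * (H o1 o0 + H o1 o1 + H o1 o2 + (H o2 o0 + H o2 o1 + H o2 o2)).
  move: ge; rewrite -lez_nat !(PoszD (square_weight _)) !square_weightE.
  by congr (_ <= _); rewrite /F /H; ring.
have uv' i j : i != o0 -> X u i j = X v' i j.
  move=> i0; apply/eqP; rewrite -subr_eq0 -sqrf_eq0 -/(S i j) eq_le S_ge0 andbT.
  clear -FE S_ge0 sumS i0; clearbody F H S; rewrite !FE in sumS.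
  have := (S_ge0 o1 o0, S_ge0 o1 o1, S_ge0 o1 o2, (S_ge0 o2 o0, S_ge0 o2 o1, S_ge0 o2 o2)).
  move=> [[[? ?] ?] [[? ?] ?]].
  by elim/ord3P: i i0 => // _; elim/ord3P: j; lia.
have Ev : u = v' by apply: point_inj => j; apply: uv'.
have Eu : u = u'.
  by apply: point_inj => j; have := Eij _ j; rewrite Ev => /(_ _)/addIr; apply.
by rewrite -Ev -Eu; case: term_order_transport.
Qed.

(** The sum of squares drops by 2(C(x - y) - C^2), and C^2 = |C| is at most C(x - y). *)
Lemma square_exchange (C x y : int) :
  C = 0 \/ C = 1 /\ 1 <= x - y \/ C = -1 /\ x - y <= -1 ->
  (x - C) ^+ 2 + (y + C) ^+ 2 <= x ^+ 2 + y ^+ 2 /\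
  (C = 1 -> 2 <= x - y -> (x - C) ^+ 2 + (y + C) ^+ 2 < x ^+ 2 + y ^+ 2).
Proof.
have E : (x - C) ^+ 2 + (y + C) ^+ 2 = x ^+ 2 + y ^+ 2 - 2 * (C * (x - y) - C ^+ 2).
  by ring.
by rewrite E; case=> [->|[[-> ?]|[-> ?]]]; rewrite ?expr2; split; lia.
Qed.

(** If the gap is at least 2, moving a conformal circuit of [u - v] through that entry from [u] to
    [v] keeps the sum and strictly lowers the square weight, which sees only rows 1 and 2. *)
Lemma pair_minimal_close u v : pair_minimal a transport_order u v ->
  forall i j, i != o0 -> X u i j - X v i j <= 1.
Proof.
move=> uv_min i j i0; rewrite leNgt; apply/negP => lt1.
pose D p q := X u p q - X v p q.
have [|||C [Crow Ccol Cij Cconf]] := @conformal_circuit D _ _ i j.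
- by move=> p; rewrite sumrB !X_row subrr.
- by move=> q; rewrite sumrB !X_col subrr.
- by rewrite /D; lia.
have [||| u' Eu'] := X_surj (f := fun p q => X u p q - C p q).
(* By conformity the new entry lies between those of [u] and [v]. *)
- by move=> p q; have := Cconf p q; have := X_ge0 u p q; have := X_ge0 v p q; rewrite /D; lia.
- by move=> p; rewrite sumrB X_row Crow subr0.
- by move=> p; rewrite sumrB X_col Ccol subr0.
have [||| v' Ev'] := X_surj (f := fun p q => X v p q + C p q).
- by move=> p q; have := Cconf p q; have := X_ge0 u p q; have := X_ge0 v p q; rewrite /D; lia.
- by move=> p; rewrite big_split /= X_row Crow addr0.
- by move=> p; rewrite big_split /= X_col Ccol addr0.
have Euv : a u + a v = a u' + a v'.
  by apply: pair_sumP => q; rewrite Eu' Ev'; ring.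
suff lt_sq : (square_weight u')%:Z + (square_weight v')%:Z <
    (square_weight u)%:Z + (square_weight v)%:Z.
  by case: (pair_minimal_weight uv_min Euv); lia.
pose F p q := X u p q ^+ 2 + X v p q ^+ 2.
pose G p q := (X u p q - C p q) ^+ 2 + (X v p q + C p q) ^+ 2.
have -> : (square_weight u)%:Z + (square_weight v)%:Z =
    F o1 o0 + F o1 o1 + F o1 o2 + (F o2 o0 + F o2 o1 + F o2 o2).
  by rewrite !square_weightE /F; ring.
have -> : (square_weight u')%:Z + (square_weight v')%:Z =
    G o1 o0 + G o1 o1 + G o1 o2 + (G o2 o0 + G o2 o1 + G o2 o2).
  by rewrite !square_weightE !Eu' !Ev' /G; ring.
have GF p q : G p q <= F p q := (square_exchange (Cconf p q)).1.
have lt_GF : G i j < F i j := (square_exchange (Cconf i j)).2 Cij lt1.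
clear -GF lt_GF i0; clearbody F G.
move: (GF o1 o0) (GF o1 o1) (GF o1 o2) (GF o2 o0) (GF o2 o1) (GF o2 o2).
by elim/ord3P: i i0 lt_GF => // _; elim/ord3P: j; lia.
Qed.

(** * Exchanges inside a product of two triangles *)

Section Cell.
Variables (y z : 'I_3 -> int) (s s' : int).

Definition at_vertex u i j :=
  (forall k, X u o1 k = y k + (if k == i then s else 0)) /\
  (forall k, X u o2 k = z k + (if k == j then s' else 0)).

Lemma at_vertex_exchange u u' v v' i i' j j' :
  at_vertex u i j -> at_vertex u' i' j' -> at_vertex v i' j -> at_vertex v' i j' ->
  a u + a u' = a v + a v'.
Proof.
move=> [yu zu] [yu' zu'] [yv zv] [yv' zv'].
by apply: pair_sumP => k; rewrite ?(yu, yu', yv, yv') ?(zu, zu', zv, zv'); ring.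
Qed.

Lemma square_weight_exchange u u' v v' i i' j j' :
  at_vertex u i j -> at_vertex u' i' j' -> at_vertex v i' j -> at_vertex v' i j' ->
  (square_weight u)%:Z + (square_weight u')%:Z =
  (square_weight v)%:Z + (square_weight v')%:Z.
Proof.
move=> [yu zu] [yu' zu'] [yv zv] [yv' zv']; rewrite !square_weightE.
by rewrite !(yu, yu', yv, yv', zu, zu', zv, zv'); ring.
Qed.

(** Expanding the form at (y + s e_i, z + s' e_j) leaves terms in at most one index, which cancel in
    an exchange, and the cross term. *)
Lemma bilinear_weight_at : exists (K : int) (L M : 'I_3 -> int),
  forall u i j, at_vertex u i j ->
  (bilinear_weight u)%:Z = K + L j + M i + s * s' * chord_weight i j.
Proof.
exists (y o1 * (2 * z o0 + z o2) + y o2 * z o1),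
  (fun j => s' * \sum_(k < 3) chord_weight k j * y k),
  (fun i => s * \sum_(k < 3) chord_weight i k * z k) => u i j [yu zu].
rewrite bilinear_weightE !big_ord3 !yu !zu.
by elim/ord3P: i {yu}; elim/ord3P: j {zu} => /=; ring.
Qed.

Lemma chord_contradiction u u' v w i i' j j' :
  pair_minimal a transport_order u u' ->
  at_vertex u i j -> at_vertex u' i' j' -> at_vertex v i' j -> at_vertex w i j' ->
  s * s' * (chord_weight i j' + chord_weight i' j) <
    s * s' * (chord_weight i j + chord_weight i' j') -> False.
Proof.
move=> uu' Hu Hu' Hv Hw lt_w.
have sq := square_weight_exchange Hu Hu' Hv Hw.
case: (pair_minimal_weight uu' (at_vertex_exchange Hu Hu' Hv Hw)) => [|[_]].
  by rewrite sq ltxx.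
have [K [L [M E]]] := bilinear_weight_at.
rewrite (E _ _ _ Hu) (E _ _ _ Hu') (E _ _ _ Hv) (E _ _ _ Hw) leNgt => /negP; apply.
rewrite !mulrDr -subr_gt0 in lt_w; rewrite -subr_gt0.
by move: lt_w; congr (_ < _); ring.
Qed.

Hypothesis s_unit : s = 1 \/ s = -1.
Hypothesis s'_unit : s' = 1 \/ s' = -1.

(** Row 0 of the base point given by [y] and [z], which need not itself be a lattice point. *)
Definition slack k := c k - y k - z k.

Lemma slack_at u i j k : at_vertex u i j ->
  0 <= slack k - (if k == i then s else 0) - (if k == j then s' else 0).
Proof.
move=> [yu zu]; have := X_ge0 u o0 k; rewrite row0E yu zu /slack.
by congr (_ <= _); ring.
Qed.

(** Row 1 is taken from [u] and row 2 from [v]; row 0 is forced by the column sums and automatically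
    has the right sum, so only its nonnegativity matters. *)
Lemma chord_point u v i i' j j' : at_vertex u i j' -> at_vertex v i' j ->
  (forall k, 0 <= slack k - (if k == i then s else 0) - (if k == j then s' else 0)) ->
  exists w, at_vertex w i j.
Proof.
move=> [yu _] [_ zv] slack_ge0.
pose f p k := if p == o0 then c k - X u o1 k - X v o2 k
  else if p == o1 then X u o1 k else X v o2 k.
have [p k|p|k|w Ew] := X_surj (f := f).
- rewrite /f; case: (p == o0); last by case: (p == o1).
  by have := slack_ge0 k; rewrite yu zv /slack; congr (_ <= _); ring.
- elim/ord3P: p; rewrite /f /= ?X_row //.
  rewrite !sumrB !X_row; have := X_row u o0.
  under eq_bigr do rewrite row0E.
  by rewrite !sumrB !X_row.
- by rewrite big_ord3 /f /=; ring.
exists w; split=> k; rewrite Ew /f /=; [exact: yu | exact: zv].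
Qed.

(** The [u] and the [v] are alternate vertices of the hexagon. Among the chords that are lattice
    points, [hexagon_descent] finds one that improves a pair of [u] or a pair of [v]. *)
Lemma hexagon_contradiction u1 u2 u3 v1 v2 v3 a1 a2 a3 b1 b2 b3 :
  uniq [:: a1; a2; a3] -> uniq [:: b1; b2; b3] ->
  at_vertex u1 a1 b1 -> at_vertex u2 a2 b2 -> at_vertex u3 a3 b3 ->
  at_vertex v1 a1 b2 -> at_vertex v2 a2 b3 -> at_vertex v3 a3 b1 ->
  pair_minimal a transport_order u1 u3 -> pair_minimal a transport_order u2 u1 ->
  pair_minimal a transport_order u3 u2 -> pair_minimal a transport_order v1 v2 ->
  pair_minimal a transport_order v2 v3 -> pair_minimal a transport_order v3 v1 ->
  False.
Proof.
move=> Ua Ub Hu1 Hu2 Hu3 Hv1 Hv2 Hv3 u13 u21 u32 v12 v23 v31.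
have one_of (i1 i2 i3 k : 'I_3) : uniq [:: i1; i2; i3] ->
    [\/ [/\ (k == i1) = true, (k == i2) = false & (k == i3) = false],
        [/\ (k == i1) = false, (k == i2) = true & (k == i3) = false]
      | [/\ (k == i1) = false, (k == i2) = false & (k == i3) = true]].
  by elim/ord3P: i1; elim/ord3P: i2; elim/ord3P: i3; elim/ord3P: k => //= _;
    try (by constructor 1); try (by constructor 2); constructor 3.
(* If a sign is 1, some vertex uses [k] for it and not for an opposite sign. If both are -1, some
   vertex avoids [k] in both indices. *)
have slack_ge k : 1 <= slack k \/ s = -1 /\ s' = -1 /\ 0 <= slack k.
  have := slack_at k Hu1; have := slack_at k Hu2; have := slack_at k Hu3.
  have := slack_at k Hv1; have := slack_at k Hv2; have := slack_at k Hv3.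
  case: (one_of _ _ _ k Ua) => -[-> -> ->]; case: (one_of _ _ _ k Ub) => -[-> -> ->];
    by move: s_unit s'_unit; clear; lia.
(* When both signs are 1, the slacks add up to [r o0 + 2], at least 4, so one of the three is at
   least 2. Otherwise [o0] is a dummy choice. *)
have [h h_slack] : exists h, s = 1 -> s' = 1 -> 2 <= slack h.
  have := X_row u1 o0; under eq_bigr do rewrite row0E.
  have [yu zu] := Hu1; rewrite big_ord3 !yu !zu => sum_slack.
  have sum_if i t : (if o0 == i then t else 0) + (if o1 == i then t else 0) +
      (if o2 == i then t else 0) = t :> int.
    by elim/ord3P: i => /=; ring.
  have [/andP[/eqP s1 /eqP s1']|ns] := boolP ((s == 1) && (s' == 1)); last first.
    by exists o0 => s1 s1'; rewrite s1 s1' in ns.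
  have [|[|]] : 2 <= slack o0 \/ 2 <= slack o1 \/ 2 <= slack o2.
  - have E : slack o0 + slack o1 + slack o2 = r o0 +
        ((if o0 == a1 then s else 0) + (if o1 == a1 then s else 0) +
         (if o2 == a1 then s else 0)) +
        ((if o0 == b1 then s' else 0) + (if o1 == b1 then s' else 0) +
         (if o2 == b1 then s' else 0)).
      by rewrite -sum_slack /slack; ring.
    by move: E; rewrite !sum_if s1 s1'; have := r0_ge2; clear; lia.
  - by exists o0.
  - by exists o1.
  - by exists o2.
(* Row 0 can turn negative only where two positive signs meet in one column of slack 1; column [h]
   has room for both. *)
have chord u v i i' j j' : at_vertex u i j' -> at_vertex v i' j ->
    [|| s != s', i != j | i == h] -> exists w, at_vertex w i j.
  move=> Hu Hv cond; apply: (chord_point Hu Hv) => k.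
  have := slack_ge k; case/or3P: cond.
  - by move: s_unit s'_unit; case: (k == i); case: (k == j); clear; lia.
  - move=> /negPf ij; move: s_unit s'_unit; case: (k =P i) => [->|_].
      by rewrite ij; clear; lia.
    by case: (k == j); clear; lia.
  - move=> /eqP->; have := h_slack; move: s_unit s'_unit.
    by case: (k =P h) => [->|_]; case: (_ == j); clear; lia.
have step (x1 x2 x3 y1 y2 y3 : 'I_N) (i1 i2 i3 j1 j2 j3 : 'I_3) :
    at_vertex x1 i1 j1 -> at_vertex x2 i2 j2 -> at_vertex x3 i3 j3 ->
    at_vertex y1 i1 j2 -> at_vertex y2 i2 j3 -> at_vertex y3 i3 j1 ->
    pair_minimal a transport_order x1 x3 -> pair_minimal a transport_order y1 y2 ->
    chord_descent (s == s') h i1 i2 i3 j1 j2 j3 -> False.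
  move=> Hx1 Hx2 Hx3 Hy1 Hy2 Hy3 x13 y12 /andP[cond desc].
  have [w Hw] := chord _ _ _ _ _ _ Hx1 Hy2 cond.
  have sgnE p q : (if s == s' then chord_weight p q else - chord_weight p q) =
      s * s' * chord_weight p q.
    by case: s_unit s'_unit => -> [] -> /=; ring.
  move: desc; rewrite !sgnE -!mulrDr => /orP[lt|lt].
    exact: chord_contradiction x13 Hx1 Hx3 Hy3 Hw lt.
  exact: chord_contradiction y12 Hy1 Hy2 Hx2 Hw lt.
by case/or3P: (hexagon_descent (s == s') h Ua Ub); apply: step; eassumption.
Qed.

End Cell.

(** * Uniqueness of the pairwise minimal monomial in a fibre *)

Lemma transport_fiber_unique m1 m2 :
  pairwise_minimal a transport_order m1 -> pairwise_minimal a transport_order m2 ->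
  same_fiber a m1 m2 -> m1 = m2.
Proof.
move=> min1 min2 /andP[/eqP deg12 /eqP sum12].
have sumX m i j : (\sum_u a u *+ m u) 0 (e i j) = \sum_u X u i j * (m u)%:Z.
  by rewrite summxE; apply: eq_bigr => u _; rewrite mulmxnE -mulr_natr natz.
have pair_in m u v : pairwise_minimal a transport_order m -> u != v ->
    (0 < m u)%N -> (0 < m v)%N -> pair_minimal a transport_order u v.
  move=> min_m uv mu mv; apply: min_m; apply/mnm_lepP => w.
  rewrite mnmDE !mnm1E; case: (u =P w) => [uw|_]; case: (v =P w) => [vw|_] //.
  - by rewrite uw vw eqxx in uv.
  - by rewrite -uw addn0.
  - by rewrite -vw.
have close m : pairwise_minimal a transport_order m -> forall i j, i != o0 ->
    forall u v, (0 < m u)%N -> (0 < m v)%N -> X u i j - X v i j <= 1.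
  move=> min_m i j i0 u v mu mv; have [->|uv] := eqVneq u v; first by rewrite subrr.
  exact: (pair_minimal_close (pair_in _ _ _ min_m uv mu mv)).
pose P u := (0 < m1 u)%N || (0 < m2 u)%N.
pose f i j := ((\sum_u X u i j * (m1 u)%:Z) %/ (mdeg m1)%:Z)%Z.
(* Coordinate sums and degree depend only on the fibre, so both monomials have the same floors [f]
   and their points share one cell. *)
have X_bounds i : i != o0 -> forall u j, P u -> f i j <= X u i j <= f i j + 1.
  move=> i0 u j /orP[m1u|m2u].
    exact: (floor_bounds (close _ min1 i j i0) m1u).
  rewrite /f -sumX sum12 sumX deg12.
  exact: (floor_bounds (close _ min2 i j i0) m2u).
have cell i : i != o0 -> exists (y : 'I_3 -> int) s (p : 'I_N -> 'I_3),
    (s = 1 \/ s = -1) /\ forall u j, P u -> X u i j = y j + (if j == p u then s else 0).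
  move=> i0; apply: simplex_cell (X_bounds i i0) _ => u _; exact: X_row.
have [y [s [p [s_unit Ep]]]] := cell o1 isT.
have [z [s' [q [s'_unit Eq]]]] := cell o2 isT.
have at_cell u : P u -> at_vertex y z s s' u (p u) (q u).
  by move=> Pu; split=> k; [exact: Ep | exact: Eq].
have cell_inj u v : P u -> P v -> p u = p v -> q u = q v -> u = v.
  move=> Pu Pv puv quv; apply: point_inj => k.
    by rewrite (Ep _ _ Pu) (Ep _ _ Pv) puv.
  by rewrite (Eq _ _ Pu) (Eq _ _ Pv) quv.
pose delta u : int := (m1 u)%:Z - (m2 u)%:Z.
have deltaP u : ~~ P u -> delta u = 0.
  by rewrite /P negb_or -!leqNgt !leqn0 => /andP[/eqP m1u /eqP m2u]; rewrite /delta m1u m2u.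
have sum_delta : \sum_u delta u = 0.
  have degE m : (mdeg m)%:Z = \sum_u (m u)%:Z.
    by rewrite mdegE -natz natr_sum; apply: eq_bigr => u _; rewrite natz.
  by rewrite sumrB -!degE deg12 subrr.
have sum_X_delta i j : \sum_u X u i j * delta u = 0.
  by under eq_bigr do rewrite mulrBr; rewrite sumrB -!sumX sum12 subrr.
(* As [delta] has total 0, the base [x] drops out of the coordinate sums, leaving [t] times the mass
   of [delta] on each index. *)
have sum_index (g : 'I_N -> 'I_3) i x t : (t = 1 \/ t = -1) ->
    (forall u j, P u -> X u i j = x j + (if j == g u then t else 0)) ->
    forall k, \sum_(u | g u == k) delta u = 0.
  move=> t_unit Eg k; have := sum_X_delta i k.
  rewrite (eq_bigr (fun u => x k * delta u + t * (if g u == k then delta u else 0))).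
    rewrite big_split /= -!mulr_sumr sum_delta mulr0 add0r -big_mkcond /=.
    by case: t_unit => ->; rewrite ?mul1r // mulN1r => /eqP; rewrite oppr_eq0 => /eqP.
  move=> u _; have [Pu|nPu] := boolP (P u); last first.
    by rewrite deltaP // !mulr0 if_same mulr0 addr0.
  by rewrite (Eg _ _ Pu) eq_sym; case: (_ == _); ring.
(* The points of the cell form a subset of the vertices of a product of two triangles, so
   m1 and m2 are 3 x 3 count matrices with equal margins; D is their difference. *)
pose D i j := \sum_(u | (p u == i) && (q u == j)) delta u.
have D_row i : \sum_j D i j = 0.
  rewrite -[RHS](sum_index p o1 y s s_unit Ep i).
  by rewrite (partition_big q xpredT).
have D_col j : \sum_i D i j = 0.
  rewrite -[RHS](sum_index q o2 z s' s'_unit Eq j).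
  rewrite (partition_big p xpredT) //=; apply: eq_bigr => i _.
  by apply: eq_bigl => u; rewrite andbC.
have D_delta u : P u -> D (p u) (q u) = delta u.
  move=> Pu; rewrite /D (bigD1 u) ?eqxx //= big1 ?addr0 // => v.
  move=> /andP[/andP[/eqP pv /eqP qv] vu]; apply: deltaP; apply/negP => Pv.
  by case/eqP: vu; apply: cell_inj.
have D_pos i j : 0 < D i j -> exists u, at_vertex y z s s' u i j /\ (0 < m1 u)%N.
  move=> Dij; have [u /andP[/andP[/eqP <- /eqP <-] du]|none] :=
    pickP (fun u => (p u == i) && (q u == j) && (0 < delta u)).
    have m1u : (0 < m1 u)%N by move: du; rewrite /delta; lia.
    by exists u; split=> //; apply: at_cell; rewrite /P m1u.
  suff : D i j <= 0 by lia.
  by apply: sumr_le0 => u ij; have := none u; rewrite /= ij /= leNgt => ->.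
have D_neg i j : D i j < 0 -> exists u, at_vertex y z s s' u i j /\ (0 < m2 u)%N.
  move=> Dij; have [u /andP[/andP[/eqP <- /eqP <-] du]|none] :=
    pickP (fun u => (p u == i) && (q u == j) && (delta u < 0)).
    have m2u : (0 < m2 u)%N by move: du; rewrite /delta; lia.
    by exists u; split=> //; apply: at_cell; rewrite /P m2u orbT.
  suff : 0 <= D i j by lia.
  by apply: sumr_ge0 => u ij; have := none u; rewrite /= ij /= leNgt => ->.
have at_neq u v i j i' j' : at_vertex y z s s' u i j -> at_vertex y z s s' v i' j' ->
    (i != i') || (j != j') -> u != v.
  move=> [yu zu] [yv zv]; apply: contraL => /eqP uv; rewrite negb_or !negbK.
  have Y := yu i; have Z := zu j; rewrite uv yv in Y; rewrite uv zv in Z.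
  apply/andP; split.
    by move: Y; rewrite eqxx; case: (i == i') => //; move: s_unit; lia.
  by move: Z; rewrite eqxx; case: (j == j') => //; move: s'_unit; lia.
apply/mnmP => u0; apply/eqP/negPn/negP => neq.
have d0 : delta u0 != 0 by rewrite subr_eq0 eqz_nat.
have Pu0 : P u0 by apply: contraNT d0 => /deltaP->.
have [i [j Dij]] : exists i j, 0 < D i j.
  exists (p u0); have := D_row (p u0); have := d0; rewrite -(D_delta _ Pu0) big_ord3.
  move=> D0 Dsum; have [|[|]] : 0 < D (p u0) o0 \/ 0 < D (p u0) o1 \/ 0 < D (p u0) o2.
  - by elim/ord3P: (q u0) D0; lia.
  - by exists o0.
  - by exists o1.
  - by exists o2.
have [m [m' [l [l' [Um Ul Dil Dmj cycle]]]]] := circulation_cycle D_row D_col Dij.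
have := Um; rewrite /= !inE !negb_or -!andbA => /and4P[im im' mm' _].
have := Ul; rewrite /= !inE !negb_or -!andbA => /and4P[jl jl' ll' _].
have [u1 [Hu1 m1u1]] := D_pos _ _ Dij.
have [v1 [Hv1 m2v1]] := D_neg _ _ Dil; have [v3 [Hv3 m2v3]] := D_neg _ _ Dmj.
case: cycle => [Dml|[Dm'l Dm'l' Dml']].
  (* A 4-cycle: the pair [u1], [u2] of [m1] and the pair [v3], [v1] of [m2] have the same sum and
     are both minimal, hence equal, although their vertices differ. *)
  have [u2 [Hu2 m1u2]] := D_pos _ _ Dml.
  have u12 : u1 != u2 by apply: (at_neq _ _ _ _ _ _ Hu1 Hu2); rewrite im.
  have v13 : v1 != v3 by apply: (at_neq _ _ _ _ _ _ Hv1 Hv3); rewrite im.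
  have E := at_vertex_exchange Hu1 Hu2 Hv3 Hv1.
  have := pair_in _ _ _ min1 u12 m1u1 m1u2.
  move=> /forallP/(_ v3)/forallP/(_ v1)/implyP; rewrite E eqxx => /(_ isT) le1.
  have := pair_in _ _ _ min2 v13 m2v1 m2v3; rewrite /pair_minimal.
  move=> /forallP/(_ u1)/forallP/(_ u2)/implyP; rewrite addrC E eqxx => /(_ isT).
  rewrite addmC => le2.
  have [_ le_anti _ _ _] := term_order_transport.
  have /mnmP/(_ u1) := le_anti _ _ (introT andP (conj le1 le2)).
  rewrite !mnmDE !mnm1E eqxx.
  have /negPf-> : v3 != u1 by apply: (at_neq _ _ _ _ _ _ Hv3 Hu1); rewrite eq_sym im.
  by have /negPf-> : v1 != u1 by apply: (at_neq _ _ _ _ _ _ Hv1 Hu1); rewrite [l == j]eq_sym jl orbT.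
have [u2 [Hu2 m1u2]] := D_pos _ _ Dm'l.
have [u3 [Hu3 m1u3]] := D_pos _ _ Dml'.
have [v2 [Hv2 m2v2]] := D_neg _ _ Dm'l'.
(* The hexagon meets the rows in the order [i], [m'], [m]. *)
have Um2 : uniq [:: i; m'; m].
  by rewrite /= !inE !negb_or im im' [m' == m]eq_sym mm'.
apply: (hexagon_contradiction s_unit s'_unit Um2 Ul Hu1 Hu2 Hu3 Hv1 Hv2 Hv3).
- by apply: (pair_in _ _ _ min1) => //; apply: (at_neq _ _ _ _ _ _ Hu1 Hu3); rewrite im.
- by apply: (pair_in _ _ _ min1) => //; apply: (at_neq _ _ _ _ _ _ Hu2 Hu1); rewrite eq_sym im'.
- by apply: (pair_in _ _ _ min1) => //; apply: (at_neq _ _ _ _ _ _ Hu3 Hu2); rewrite mm'.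
- by apply: (pair_in _ _ _ min2) => //; apply: (at_neq _ _ _ _ _ _ Hv1 Hv2); rewrite im'.
- by apply: (pair_in _ _ _ min2) => //; apply: (at_neq _ _ _ _ _ _ Hv2 Hv3); rewrite eq_sym mm'.
- by apply: (pair_in _ _ _ min2) => //; apply: (at_neq _ _ _ _ _ _ Hv3 Hv1); rewrite eq_sym im.
Qed.

Lemma transport_initial_ideal (k : fieldType) :
  has_squarefree_quadratic_initial_ideal (toric_ideal k a).
Proof.
apply: (pairwise_minimal_groebner _ _ term_order_transport).
- by move=> u q; have [i [j ->]] := e_surj q.
- exact: pair_minimal_square.
- exact: transport_fiber_unique.
Qed.

End Transportation.

(** * Reduction of the theorem to a large sum in row 0 *)

Lemma lattice_pointP (R : realType) (r c : 'rV[int]_3) (v : 'rV[int]_(3 * 3)) :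
  map_mx intr v \in transportation_polytope R r c <->
  [/\ forall i j, 0 <= v 0 (mxvec_index i j),
      forall i, \sum_j v 0 (mxvec_index i j) = r 0 i
    & forall j, \sum_i v 0 (mxvec_index i j) = c 0 j].
Proof.
have E i j : vec_mx (map_mx intr v : 'rV[R]_(3 * 3)) i j = (v 0 (mxvec_index i j))%:~R.
  by rewrite !mxE.
split=> [/and3P[/forallP P0 /forallP Pr /forallP Pc]|[P0 Pr Pc]].
  split=> [i j|i|j].
  - by have /forallP/(_ j) := P0 i; rewrite E ler0z.
  - have /eqP := Pr i; under eq_bigr do rewrite E.
    by rewrite -rmorph_sum => /intr_inj.
  - have /eqP := Pc j; under eq_bigr do rewrite E.
    by rewrite -rmorph_sum => /intr_inj.
apply/and3P; split; apply/forallP => i.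
- by apply/forallP => j; rewrite E ler0z.
- by under eq_bigr do rewrite E; rewrite -rmorph_sum Pr.
- by under eq_bigr do rewrite E; rewrite -rmorph_sum Pc.
Qed.

Theorem theorem1p3 (R : realType) (k : fieldType) (r c : 'rV[int]_3)
  (r_gt0 : forall i, 0 < r 0 i) (c_gt0 : forall j, 0 < c 0 j)
  (sum_rc : \sum_i r 0 i = \sum_j c 0 j)
  (not_birkhoff : ~ birkhoff_multiple r c)
  (N : nat) (a : 'I_N -> 'rV[int]_(3 * 3))
  (a_enum : enumerates_lattice_points (transportation_polytope R r c) a) :
  has_squarefree_quadratic_initial_ideal (toric_ideal k a).
Proof.
have [a_inj aP] := a_enum.
have a_pt u := (lattice_pointP R r c (a u)).1 ((aP (a u)).2 (ex_intro _ u erefl)).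
have a_surj (g : 'I_3 -> 'I_3 -> int) : (forall i j, 0 <= g i j) ->
    (forall i, \sum_j g i j = r 0 i) -> (forall j, \sum_i g i j = c 0 j) ->
    exists u, forall i j, a u 0 (mxvec_index i j) = g i j.
  move=> g0 gr gc; pose v := mxvec (\matrix_(i, j) g i j).
  have vE i j : v 0 (mxvec_index i j) = g i j by rewrite mxvecE mxE.
  have /aP[u Eu] : map_mx intr v \in transportation_polytope R r c.
    apply/lattice_pointP; split=> [i j|i|j]; first by rewrite vE.
      by under eq_bigr do rewrite vE.
    by under eq_bigr do rewrite vE.
  by exists u => i j; rewrite -Eu vE.
have sum_tperm i0 (g : 'I_3 -> int) : \sum_i g (tperm o0 i0 i) = \sum_i g i.
  by rewrite [RHS](reindex_inj (@perm_inj _ (tperm o0 i0))).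
(* If no line sum reaches 2, all of them are 1, which is the excluded polytope B_3 itself. *)
have [[i0 ri0]|[j0 cj0]] : (exists i, 2 <= r 0 i) \/ (exists j, 2 <= c 0 j).
- have [/existsP[i ri]|nr] := boolP [exists i, 2 <= r 0 i]; first by left; exists i.
  have [/existsP[j cj]|nc] := boolP [exists j, 2 <= c 0 j]; first by right; exists j.
  case: not_birkhoff; exists 1; split=> //; apply/rowP => i; rewrite mxE.
    move: nr; rewrite negb_exists => /forallP/(_ i); have := r_gt0 i; lia.
  move: nc; rewrite negb_exists => /forallP/(_ i); have := c_gt0 i; lia.
(* A transposition of rows brings the large sum to row 0. *)
- apply: (@transport_initial_ideal _ _ a (fun i j => mxvec_index (tperm o0 i0 i) j)
    (fun i => r 0 (tperm o0 i0 i)) (c 0)) => //.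
  + move=> q; case/mxvec_indexP: q => i j.
    by exists (tperm o0 i0 i), j; rewrite tpermK.
  + by move=> u i j; have [] := a_pt u.
  + by move=> u i; have [_ ->] := a_pt u.
  + move=> u j; rewrite (sum_tperm i0 (fun i => a u 0 (mxvec_index i j))).
    by have [] := a_pt u.
  + move=> g g0 gr gc.
    have [||j|u Eu] := a_surj (fun i j => g (tperm o0 i0 i) j).
    * by move=> i j.
    * by move=> i; rewrite gr tpermK.
    * by rewrite (sum_tperm i0 (fun i => g i j)).
    by exists u => i j; rewrite Eu tpermK.
  + by rewrite tpermL.
(* For a large column sum the matrix is transposed as well. *)
- apply: (@transport_initial_ideal _ _ a (fun i j => mxvec_index j (tperm o0 j0 i))
    (fun i => c 0 (tperm o0 j0 i)) (r 0)) => //.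
  + move=> q; case/mxvec_indexP: q => i j.
    by exists (tperm o0 j0 j), i; rewrite tpermK.
  + by move=> u i j; have [] := a_pt u.
  + by move=> u i; have [_ _ ->] := a_pt u.
  + move=> u j; rewrite (sum_tperm j0 (fun i => a u 0 (mxvec_index j i))).
    by have [] := a_pt u.
  + move=> g g0 gr gc.
    have [||j|u Eu] := a_surj (fun i j => g (tperm o0 j0 j) i).
    * by move=> i j.
    * by move=> i; rewrite (sum_tperm j0 (fun j => g j i)).
    * by rewrite gr tpermK.
    by exists u => i j; rewrite Eu tpermK.
  + by rewrite tpermL.
Qed.
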